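(* Let $m\in\{1,2,\ldots\}$, let $\rho>0$ and $M\in S_\rho^-$. Then \[\partial_\rho^kM=\partial_\rho^{1-k}(M^c\cap\Delta_\rho)\quad\text{for all }k\in\mathbb{Z}.\]
   Context: $\mathbb{R}^m$ carries the maximum norm $\|x\|_\infty=\max_{1\le j\le m}|x_j|$. For a point $x\in\mathbb{R}^m$ and nonempty $A\subset\mathbb{R}^m$, $\mathrm{d}(x,A)=\inf_{y\in A}\|x-y\|_\infty$, and $\mathrm{d}(x,\emptyset)=\infty$. $M^c$ is the complement in $\mathbb{R}^m$. $\Delta_\rho=\rho\mathbb{Z}^m$ and $S_\rho^-=\{M\subset\Delta_\rho:\emptyset\neq M\neq\Delta_\rho\}$. For $M\subset\Delta_\rho$ define $\partial^0_\rho M=\{x\in M:\exists z\in M^c\cap\Delta_\rho\text{ with }\|x-z\|_\infty=\rho\}$, and for integers $k\ge1$, $\partial^k_\rho M=\{z\in M^c\cap\Delta_\rho:\mathrm{d}(z,\partial^0_\rho M)=k\rho\}$ and $\partial^{-k}_\rho M=\{x\in M:\mathrm{d}(x,\partial^0_\rho M)=k\rho\}$. *)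

(* Defs.v *)
From HB Require Import structures.
From mathcomp Require Import all_boot all_order all_algebra.
From mathcomp Require Import all_classical all_reals all_analysis.
Set Implicit Arguments.
Unset Strict Implicit.
Unset Printing Implicit Defensive.
Import Order.TTheory GRing.Theory Num.Theory.
Import numFieldNormedType.Exports.
Local Open Scope classical_set_scope.
Local Open Scope ring_scope.

(** R^m is ['rV[R]_m]; its library norm [`|x|] is the maximum norm ([mx_norm]). *)

(** The infimum is taken in [\bar R], so the distance to [set0] is [+oo]. *)
Definition dist (R : realType) (m : nat) (x : 'rV[R]_m) (A : set 'rV[R]_m) :
    \bar R :=
  ereal_inf [set `|x - y|%:E | y in A].

Definition grid (R : realType) (m : nat) (rho : R) : set 'rV[R]_m :=
  [set rho *: map_mx intr z | z in [set: 'rV[int]_m]].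

Arguments grid {R} m rho.

Definition proper_grid_sets (R : realType) (m : nat) (rho : R) :
    set (set 'rV[R]_m) :=
  [set M | M `<=` grid m rho /\ M !=set0 /\ M <> grid m rho].

Arguments proper_grid_sets {R} m rho.

Definition boundary0 (R : realType) (m : nat) (rho : R) (M : set 'rV[R]_m) :
    set 'rV[R]_m :=
  [set x | M x /\ exists z, (~` M `&` grid m rho) z /\ `|x - z| = rho].

(** Since [Negz n] is the integer [- n.+1], the last two cases are the layers
    with positive and negative index, both at distance [n.+1 * rho]. *)
Definition boundary (R : realType) (m : nat) (rho : R) (k : int)
    (M : set 'rV[R]_m) : set 'rV[R]_m :=
  match k with
  | Posz 0 => boundary0 rho M
  | Posz n.+1 =>
      [set z | (~` M `&` grid m rho) z /\
               dist z (boundary0 rho M) = (n.+1%:R * rho)%:E]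
  | Negz n =>
      [set x | M x /\ dist x (boundary0 rho M) = (n.+1%:R * rho)%:E]
  end.

(* Main.v *)
Require Import Defs.
From HB Require Import structures.
From mathcomp Require Import all_boot all_order all_algebra.
From mathcomp Require Import all_classical all_reals all_analysis.
From mathcomp Require Import zify lra.
Import Order.TTheory GRing.Theory Num.Theory.
Import numFieldNormedType.Exports.
Local Open Scope classical_set_scope.
Local Open Scope ring_scope.

(** Let [N] be the complement of [M] in the grid.  Everything follows from one
    identity: a point [z] of [N] satisfies
    [dist z (boundary0 M) = dist z (boundary0 N) + rho].

    The bound from above ([dist_boundary0_le]) holds because each point of
    [boundary0 N] has a point of [boundary0 M] at distance [rho].  The bound
    from below ([dist_boundary0_ge]) holds because grid distances are realised
    by king-move paths: walking from a point of [boundary0 M] towards [z], each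
    step has length [rho] and brings the walker closer by [rho]
    ([grid_step_towards]).  Since [z] lies outside [M], the walk leaves [M], and
    the first point outside [M] is in [boundary0 N] and at least [rho] closer
    to [z] than the starting point ([boundary0_compl_closer]).

    Hence the layer of [N] at distance [n.+2 * rho] from [boundary0 M] is the one
    at distance [n.+1 * rho] from [boundary0 N].  For the layer at distance [rho]
    one obtains the points at distance [0] from [boundary0 N], which are the
    points of [boundary0 N] because distinct grid points are at least [rho]
    apart.  This proves the formula for positive indices
    ([boundary_pos_compl]); for the other ones exchange [M] and [N]. *)

(** * The maximum norm on the grid *)

Lemma rV_norm_leP {R : realType} {m : nat} {x : 'rV[R]_m} {r : R} :
  0 <= r -> reflect (forall j, `|x 0 j| <= r) (`|x| <= r).
Proof.
move=> r0; rewrite [`|x|]mx_normrE; apply: (iffP idP) => [xr j|xr].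
  apply: le_trans xr.
  exact: (le_bigmax_cond _ (fun ij => `|x ij.1 ij.2|) (j := (0, j))).
by apply: bigmax_le => // -[i j] _ /=; rewrite ord1.
Qed.

Lemma grid_norm_leP {R : realType} {m : nat} {rho : R} (hrho : 0 < rho)
    {u : 'rV[int]_m} {k : nat} :
  reflect (forall j, `|u 0 j| <= k%:Z) (`|rho *: map_mx intr u| <= k%:R * rho).
Proof.
have k0 : 0 <= k%:R * rho by rewrite mulr_ge0 // ltW.
have entry j : (`|(rho *: map_mx intr u) 0 j| <= k%:R * rho) = (`|u 0 j| <= k%:Z).
  by rewrite !mxE normrM gtr0_norm // mulrC ler_pM2r // -intr_norm pmulrn ler_int.
by apply: (iffP (rV_norm_leP k0)) => h j; have := h j; rewrite entry.
Qed.

Lemma grid_norm_nat {R : realType} {m : nat} {rho : R} (hrho : 0 < rho)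
    (u : 'rV[int]_m) :
  exists k : nat, `|rho *: map_mx intr u| = k%:R * rho.
Proof.
set x := rho *: _.
have [x0|/mx_norm_neq0[[i j] /= xij]] := eqVneq (mx_norm x) 0.
  by exists 0%N; rewrite mul0r.
exists `|u i j|%N; rewrite [LHS]xij !mxE normrM gtr0_norm // mulrC.
by rewrite natr_absz intr_norm.
Qed.

Lemma grid_sub {R : realType} {m : nat} {rho : R} (u v : 'rV[int]_m) :
  rho *: map_mx intr u - rho *: map_mx intr v
    = rho *: map_mx intr (u - v) :> 'rV[R]_m.
Proof. by rewrite -scalerBr map_mxB. Qed.

Lemma grid_dist_nat {R : realType} {m : nat} {rho : R} (hrho : 0 < rho)
    {x y : 'rV[R]_m} :
  grid m rho x -> grid m rho y -> exists k : nat, `|x - y| = k%:R * rho.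
Proof. by move=> [u _ <-] [v _ <-]; rewrite grid_sub; exact: grid_norm_nat. Qed.

Lemma grid_separated {R : realType} {m : nat} {rho : R} (hrho : 0 < rho)
    {x y : 'rV[R]_m} :
  grid m rho x -> grid m rho y -> `|x - y| < rho -> x = y.
Proof.
move=> gx gy; have [k kE] := grid_dist_nat hrho gx gy.
rewrite kE gtr_pMl // ltrn1 ltnS leqn0 => /eqP k0.
by apply/eqP; rewrite -subr_eq0 -normr_eq0 kE k0 mul0r.
Qed.

Lemma int_step_towards (a b : int) (k : nat) :
  `|a - b| <= k.+1%:Z -> `|a - (b + sgz (a - b))| <= k%:Z.
Proof. lia. Qed.

Lemma int_step_le1 (a b : int) : `|a - (a + sgz b)| <= 1%:Z.
Proof. lia. Qed.

(** One move along a geodesic: every coordinate moves by one unit towards the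
    corresponding coordinate of [z], unless it has already reached it. *)
Lemma grid_step_towards {R : realType} {m : nat} {rho : R} (hrho : 0 < rho)
    {x z : 'rV[R]_m} {k : nat} :
  grid m rho x -> grid m rho z -> `|z - x| = k.+1%:R * rho ->
  exists y, [/\ grid m rho y, `|x - y| = rho & `|z - y| <= k%:R * rho].
Proof.
move=> gx gz zxk; have [u _ ux] := gx; have [w _ wz] := gz.
have /(grid_norm_leP hrho) uw : `|rho *: map_mx intr (w - u)| <= k.+1%:R * rho.
  by rewrite -grid_sub ux wz zxk.
pose v : 'rV[int]_m := \row_j (u 0 j + sgz (w 0 j - u 0 j)).
pose y : 'rV[R]_m := rho *: map_mx intr v.
have gy : grid m rho y by exists v.
have zy : `|z - y| <= k%:R * rho.
  rewrite -wz grid_sub; apply/(grid_norm_leP hrho) => j.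
  by have := uw j; rewrite !mxE; exact: int_step_towards.
have xy : `|x - y| <= 1%:R * rho.
  rewrite -ux grid_sub; apply/(grid_norm_leP hrho) => j.
  by rewrite !mxE; exact: int_step_le1.
exists y; split => //; apply/eqP; rewrite eq_le -{1}[rho]mul1r xy /= leNgt.
apply/negP => /(grid_separated hrho gx gy) xyE.
by move: zy; rewrite -xyE zxk ler_pM2r // ler_nat ltnn.
Qed.

(** * Complementary boundaries *)

Lemma grid_complK {R : realType} {m : nat} {rho : R} {M : set 'rV[R]_m} :
  M `<=` grid m rho -> ~` (~` M `&` grid m rho) `&` grid m rho = M.
Proof.
move=> sM; rewrite setCI setCK setIUl setICl setU0.
exact/setIidl.
Qed.

(** The walk from [x] towards [z] is a recursion on the distance to [z]: it
    stops at the first point outside [M], whose predecessor in [M] witnesses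
    that it is a boundary point of the complement. *)
Lemma boundary0_compl_closer {R : realType} {m : nat} {rho : R}
    (hrho : 0 < rho) {M : set 'rV[R]_m} (sM : M `<=` grid m rho)
    {x z : 'rV[R]_m} :
  M x -> (~` M `&` grid m rho) z ->
  exists2 y, boundary0 rho (~` M `&` grid m rho) y & `|z - y| + rho <= `|z - x|.
Proof.
move=> Mx Nz; have gz := Nz.2.
have [k] := grid_dist_nat hrho gz (sM x Mx).
elim/ltn_ind: k x Mx => -[|k] IH x Mx zxk.
  have zx : z = x by apply/eqP; rewrite -subr_eq0 -normr_eq0 zxk mul0r.
  by case: Nz.1; rewrite zx.
have [y [gy xy zy]] := grid_step_towards hrho (sM x Mx) gz zxk.
have zyx : `|z - y| + rho <= `|z - x| by rewrite zxk -natr1 mulrDl mul1r lerD2r.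
have [My|NMy] := pselect (M y); last first.
  exists y => //; split => //; exists x; rewrite grid_complK //.
  by rewrite distrC.
have [j zyj] := grid_dist_nat hrho gz gy.
have jk : (j < k.+1)%N by move: zy; rewrite zyj ler_pM2r // ler_nat.
have [y' by' zy'] := IH j jk y My zyj.
by exists y' => //; move: hrho zy' zyx; lra.
Qed.

Lemma dist_boundary0_le {R : realType} {m : nat} {rho : R}
    {M : set 'rV[R]_m} (sM : M `<=` grid m rho) {z : 'rV[R]_m} :
  (dist z (boundary0 rho M)
     <= dist z (boundary0 rho (~` M `&` grid m rho)) + rho%:E)%E.
Proof.
rewrite -leeBlDr //; apply/ereal_infP => _ [y [Ny [x [+ yx]]] <-].
rewrite grid_complK // => Mx; rewrite leeBlDr // -EFinD.
apply: ge_ereal_inf; exists `|z - x|%:E.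
  by exists x => //; split => //; exists y; rewrite distrC.
by rewrite lee_fin -yx ler_distD.
Qed.

Lemma dist_boundary0_ge {R : realType} {m : nat} {rho : R} (hrho : 0 < rho)
    {M : set 'rV[R]_m} (sM : M `<=` grid m rho) {z : 'rV[R]_m} :
  (~` M `&` grid m rho) z ->
  (dist z (boundary0 rho (~` M `&` grid m rho)) + rho%:E
     <= dist z (boundary0 rho M))%E.
Proof.
move=> Nz; apply/ereal_infP => _ [x [Mx _] <-].
have [y Ny zyx] := boundary0_compl_closer hrho sM Mx Nz.
apply: (@le_trans _ _ (`|z - y| + rho)%:E); last by rewrite lee_fin.
by rewrite EFinD leeD2r //; apply: ereal_inf_lbound; exists y.
Qed.

Lemma dist_boundary0_compl {R : realType} {m : nat} {rho : R} (hrho : 0 < rho)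
    {M : set 'rV[R]_m} (sM : M `<=` grid m rho) {z : 'rV[R]_m} :
  (~` M `&` grid m rho) z ->
  dist z (boundary0 rho M)
    = (dist z (boundary0 rho (~` M `&` grid m rho)) + rho%:E)%E.
Proof.
move=> Nz; apply/eqP.
by rewrite eq_le dist_boundary0_le // dist_boundary0_ge.
Qed.

(** The infimum is attained here because the grid is discrete. *)
Lemma dist_grid_eq0 {R : realType} {m : nat} {rho : R} (hrho : 0 < rho)
    {A : set 'rV[R]_m} (sA : A `<=` grid m rho) {z : 'rV[R]_m} :
  grid m rho z -> dist z A = 0%E <-> A z.
Proof.
move=> gz; split => [d0|Az].
  have : (dist z A < rho%:E)%E by rewrite d0 lte_fin.
  move=> /ereal_inf_ltP[_ [y Ay <-]]; rewrite lte_fin => zy.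
  by rewrite (grid_separated hrho gz (sA y Ay) zy).
apply/eqP; rewrite eq_le; apply/andP; split.
  by apply: ge_ereal_inf; exists 0%E => //; exists z => //; rewrite subrr normr0.
by apply/ereal_infP => _ [y _ <-]; rewrite lee_fin.
Qed.

Lemma boundary_pos_compl {R : realType} {m : nat} {rho : R} (hrho : 0 < rho)
    {M : set 'rV[R]_m} (sM : M `<=` grid m rho) (n : nat) :
  boundary rho n.+1%:Z M = boundary rho (- n%:Z) (~` M `&` grid m rho).
Proof.
set N := ~` M `&` grid m rho.
have layer z : N z -> dist z (boundary0 rho M) = (n.+1%:R * rho)%:E <->
                      dist z (boundary0 rho N) = (n%:R * rho)%:E.
  move=> Nz; rewrite dist_boundary0_compl // -natr1 mulrDl mul1r EFinD.
  by split=> [/(congr1 (fun t => t - rho%:E)%E)|->//]; rewrite !addeK.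
case: n layer => [|n] layer; apply/seteqP; split => z.
- move=> [Nz /(layer z Nz)]; rewrite mul0r => /(dist_grid_eq0 hrho) h.
  by apply: h => [y [[]]|]; last exact: Nz.2.
- move=> bz; have Nz : N z by exact: bz.1.
  split=> //; apply/(layer z Nz); rewrite mul0r.
  by apply/(dist_grid_eq0 hrho) => //; [move=> y [[]]|exact: Nz.2].
- by move=> [Nz /(layer z Nz)].
- by move=> [Nz /(layer z Nz)].
Qed.

Theorem proposition12 (R : realType) (m : nat) (hm : (1 <= m)%N)
    (rho : R) (hrho : 0 < rho)
    (M : set 'rV[R]_m) (hM : proper_grid_sets m rho M) :
  forall k : int,
    boundary rho k M = boundary rho (1 - k) (~` M `&` grid m rho).
Proof.
have sM := hM.1; move=> k.
have nonpos n : boundary rho (- n%:Z) M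
    = boundary rho n.+1%:Z (~` M `&` grid m rho).
  by rewrite boundary_pos_compl ?grid_complK //; exact: subIsetr.
case: k => [[|n]|n].
- exact: (nonpos 0%N).
- by rewrite boundary_pos_compl //; congr boundary; lia.
- by rewrite NegzE nonpos; congr boundary; lia.
Qed.
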